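(* Let $A$ be a set and let $v:A\to A$ be an injective function. Then $A$ decomposes uniquely as a disjoint union $A=A_0\sqcup A_1$ where $A_0$ and $A_1$ are left invariant by $v$ (that is, $v(A_0)\subseteq A_0$ and $v(A_1)\subseteq A_1$), $v|_{A_0}:A_0\to A_0$ is a shift, and $v|_{A_1}:A_1\to A_1$ is a bijection.
   Context: An injective function $w:X\to X$ on a set $X$ is called a shift if $\bigcap_{n=0}^{\infty} w^n(X)=\emptyset$ (with $w^0$ the identity). The sets $A_0$, $A_1$ are allowed to be empty. *)

(* Defs.v *)
From mathcomp Require Import all_boot.
From mathcomp Require Import boolp classical_sets functions.

Set Implicit Arguments.
Unset Strict Implicit.
Unset Printing Implicit Defensive.

Local Open Scope classical_set_scope.

(* "w restricts to a shift X -> X".  As with the library's set_fun, set_inj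
   and set_bij, w is total on T and only its values on X matter; since w maps
   X to X, iter n w @` X is the image of the n-th iterate of the restriction. *)
Definition is_shift (T : Type) (X : set T) (w : T -> T) : Prop :=
  [/\ set_fun X X w, set_inj X w & \bigcap_n (iter n w @` X) = set0].

(* Main.v *)
Require Import Defs.
From mathcomp Require Import all_boot.
From mathcomp Require Import boolp classical_sets functions.

(** The bijective part can only be the core of v, the set of points that have
    an n-th preimage for every n.  The core is stable under v, and because v is
    injective a point whose image has arbitrarily long backward orbits has them
    too ([core_reflect]).  Hence the complement of the core is also stable, v
    maps the core onto itself, and any point with arbitrarily old ancestors in
    the complement would lie in the core, so v is a shift on the complement.

    Conversely, in any decomposition A0, A1, surjectivity on A1 puts A1 inside
    the core, while a core point in A0 would have all its ancestors in A0
    (those in A1 have all their descendants in A1), against the shift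
    condition.  So A1 is the core and A0 its complement. *)

Set Implicit Arguments.
Unset Strict Implicit.
Unset Printing Implicit Defensive.

Local Open Scope classical_set_scope.

Definition core (T : Type) (v : T -> T) : set T := \bigcap_n range (iter n v).

Lemma iter_stable (T : Type) (v : T -> T) (X : set T) (n : nat) (x : T) :
  v @` X `<=` X -> X x -> X (iter n v x).
Proof.
by move=> vX Xx; elim: n => [//|n IHn]; apply: vX; exists (iter n v x).
Qed.

Lemma core_stable (T : Type) (v : T -> T) : v @` core v `<=` core v.
Proof.
move=> _ [x cx <-] n _; have [y _ <-] := cx n I.
by exists (v y) => //; rewrite -iterSr.
Qed.

(** An (n+1)-st preimage of v x is an n-th preimage of x, as one application of
    v can be cancelled. *)
Lemma core_reflect (T : Type) (v : T -> T) (x : T) :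
  injective v -> core v (v x) -> core v x.
Proof.
move=> injv cvx n _; have [y _ /injv <-] := cvx n.+1 I.
by exists y.
Qed.

Lemma core_bij (T : Type) (v : T -> T) :
  injective v -> set_bij (core v) (core v) v.
Proof.
move=> injv; split.
- by move=> x cx; apply: core_stable; exists x.
- by move=> x y _ _ /injv.
- move=> x cx; have [y _ vyx] := cx 1 I.
  by exists y => //; apply: core_reflect => //; rewrite [v y]vyx.
Qed.

Lemma setC_core_shift (T : Type) (v : T -> T) :
  injective v -> is_shift (~` core v) v.
Proof.
move=> injv; split.
- by move=> x ncx /(core_reflect injv).
- by move=> x y _ _ /injv.
- rewrite -subset0 => x xX.
  (* the 0-th iterate says that x itself is outside the core *)
  have [y ncy /= yx] := xX 0 I; rewrite {}yx in ncy; apply: ncy => n _.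
  by have [z _ <-] := xX n I; exists z.
Qed.

(** Preimages can always be chosen inside X, so taking them can be iterated. *)
Lemma surj_sub_core (T : Type) (v : T -> T) (X : set T) :
  set_surj X X v -> X `<=` core v.
Proof.
move=> surjv x Xx n _.
suff [y _ <-] : (iter n v @` X) x by exists y.
elim: n x Xx => [|n IHn] x Xx; first by exists x.
have [y Xy <-] := surjv x Xx; have [z Xz <-] := IHn y Xy.
by exists z.
Qed.

(** Stability of X says that descendants of X stay in X; so the ancestors of
    a point outside X all lie outside X, and a core point there would be a
    forbidden point of the shift. *)
Lemma core_sub_of_shift (T : Type) (v : T -> T) (X : set T) :
  v @` X `<=` X -> is_shift (~` X) v -> core v `<=` X.
Proof.
move=> vX [_ _ shiftv] x cx; apply: contrapT => nXx.
suff : set0 x by [].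
rewrite -shiftv => n _; have [y _ yx] := cx n I.
by exists y => // Xy; apply: nXx; rewrite -yx; apply: iter_stable.
Qed.

Theorem theorem1p3 (A : Type) (v : A -> A) (injv : injective v) :
  exists! A01 : set A * set A,
    let: (A0, A1) := A01 in
    (A0 `|` A1 = setT /\ A0 `&` A1 = set0) /\
    (v @` A0 `<=` A0 /\ v @` A1 `<=` A1) /\
    is_shift A0 v /\
    set_bij A1 A1 v.
Proof.
exists (~` core v, core v); split.
  split; first by rewrite setvU setICl.
  split; last by split; [apply: setC_core_shift | apply: core_bij].
  split; last exact: core_stable.
  by move=> _ [x ncx <-] /(core_reflect injv).
move=> [A0 A1] [[UA IA] [[_ vA1] [shiftA0 [_ _ surjA1]]]].
have A0E : A0 = ~` A1.
  apply/seteqP; split => x; first by move=> A0x A1x; rewrite -[False]/(set0 x) -IA.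
  by move=> nA1x; have : setT x by []; rewrite -UA => -[].
rewrite A0E in shiftA0 *.
suff -> : core v = A1 by [].
apply/seteqP; split; [exact: core_sub_of_shift | exact: surj_sub_core].
Qed.
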